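(* $z_L(5,4)=12$.
   Context: **Classical Zarankiewicz number.** For $m\ge n\ge 2$, $z(m,n)$ is the maximum number of edges in a bipartite graph with parts $S=[m]=\{1,\dots,m\}$ and $T=[n]=\{1,\dots,n\}$ that contains no $K_{2,2}$ (equivalently, no cycle $C_4$). **Limited augmented bipartite graphs.** Let $G_1=(S,T,E_1)$ with $S=[m]$, $T=[n]$ be a $C_4$-free bipartite graph with $|E_1|=z(m,n)$. A limited augmented bipartite graph $G=(S,T,E_1\cup E_2)$ augmented from $G_1$ consists of the set $E_1$ of 1-edges (pairs, or ''cells'', $(i,j)\in S\times T$) and a set $E_2$ of 2-edges. A 2-edge is a quadruple $(i,j;k,l)$ with $i,k\in S$, $j,l\in T$, where the case $i=k$ and $j=l$ is forbidden; it is regarded as an unordered pair of the two distinct cells $(i,j)$ and $(k,l)$, called its halves. It is nondegenerate if $i\ne k$ and $j\ne l$, row-degenerate if $i=k$ and $j\neq l$, and column-degenerate if $i\ne k$ and $j=l$. The simplicity condition is imposed: no 2-edge shares a cell with any 1-edge or with another 2-edge. **Generalized $C_4$-cycles.** A cell $(i,j)$ is occupied if $(i,j)\in E_1$ or $(i,j)$ is a half of some 2-edge in $E_2$. The graph $G$ contains a generalized $C_4$-cycle if any of the following holds: 1. There is a classical $C_4$-cycle formed by 1-edges. 2. There is a nondegenerate 2-edge $(i,j;k,l)\in E_2$ such that both cells $(i,l)$ and $(k,j)$ are occupied. 3. There are a 2-edge $(i,j;p,q)\in E_2$ (of any type) and a cell $(k,l)$ with $k\notin\{i,p\}$ and $l\notin\{j,q\}$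 such that the five cells $(k,l),(k,j),(k,q),(i,l),(p,l)$ are all occupied; if the 2-edge is nondegenerate, these five cells must moreover be pairwise distinct. **Limited augmented Zarankiewicz number.** $z_L(m,n)$ is the maximum of $|E_1|+|E_2|$ over all $m\times n$ limited augmented bipartite graphs $G=(S,T,E_1\cup E_2)$ (augmented from a $C_4$-free graph with $|E_1|=z(m,n)$, satisfying the simplicity condition) that contain no generalized $C_4$-cycle. *)

(* Defs.v *)
From mathcomp Require Import all_boot.

Set Implicit Arguments.
Unset Strict Implicit.
Unset Printing Implicit Defensive.

(* A bipartite graph with parts [m] and [n] is given by its set of edges, seen
   as cells of an m x n grid; the parts are indexed from 0. *)
Definition cell (m n : nat) : finType := ('I_m * 'I_n)%type.

Definition has_C4 (m n : nat) (E : {set cell m n}) : bool :=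
  [exists i, exists k, exists j, exists l,
    [&& i != k, j != l, (i, j) \in E, (i, l) \in E, (k, j) \in E
      & (k, l) \in E]].

(* The maximum is over a nonempty family, since the empty graph is C4-free. *)
Definition zarankiewicz (m n : nat) : nat :=
  \max_(E : {set cell m n} | ~~ has_C4 E) #|E|.

(* A 2-edge (i,j;k,l) is the set [set (i, j); (k, l)] of its two halves. *)
Definition aug_graph (m n : nat) : finType :=
  ({set cell m n} * {set {set cell m n}})%type.

Definition edges1 (m n : nat) (G : aug_graph m n) : {set cell m n} := G.1.
Definition edges2 (m n : nat) (G : aug_graph m n) : {set {set cell m n}} := G.2.

(* [trivIset] says that distinct 2-edges share no cell. *)
Definition limited_augmented (m n : nat) (G : aug_graph m n) : bool :=
  [&& ~~ has_C4 (edges1 G), #|edges1 G| == zarankiewicz m n,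
      [forall e in edges2 G, #|e| == 2],
      [forall e in edges2 G, [disjoint e & edges1 G]]
    & trivIset (edges2 G)].

Definition occupied (m n : nat) (G : aug_graph m n) (c : cell m n) : bool :=
  (c \in edges1 G) || [exists e in edges2 G, c \in e].

Definition nondegenerate (m n : nat) (a b : cell m n) : bool :=
  (a.1 != b.1) && (a.2 != b.2).

Definition gen_C4_two (m n : nat) (G : aug_graph m n) : bool :=
  [exists i, exists j, exists k, exists l,
    [&& [set (i, j); (k, l)] \in edges2 G, nondegenerate (i, j) (k, l),
        occupied G (i, l) & occupied G (k, j)]].

Definition gen_C4_three (m n : nat) (G : aug_graph m n) : bool :=
  [exists i, exists j, exists p, exists q, exists k, exists l,
    let cells := [:: (k, l); (k, j); (k, q); (i, l); (p, l)] in
    [&& [set (i, j); (p, q)] \in edges2 G,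
        k \notin [:: i; p], l \notin [:: j; q],
        all (occupied G) cells
      & nondegenerate (i, j) (p, q) ==> uniq cells]].

Definition has_gen_C4 (m n : nat) (G : aug_graph m n) : bool :=
  [|| has_C4 (edges1 G), gen_C4_two G | gen_C4_three G].

(* The maximum is over a nonempty family, since an extremal C4-free graph
   without 2-edges is admissible. *)
Definition limited_zarankiewicz (m n : nat) : nat :=
  \max_(G : aug_graph m n | limited_augmented G && ~~ has_gen_C4 G)
     (#|edges1 G| + #|edges2 G|).

(* Main.v *)
Require Import Defs.
From mathcomp Require Import all_boot.
From mathcomp Require Import zify.

Set Implicit Arguments.
Unset Strict Implicit.
Unset Printing Implicit Defensive.

(** Why twelve.  A C4-free graph on a grid of 5 rows and 4 columns has at most
    10 edges, since each of the 6 pairs of columns is used by at most one row.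
    So the claim is that two 2-edges can be added to some extremal graph, which
    [witness] shows, and that three never can ([at_most_two_2edges]).

    With three 2-edges, 10 + 6 of the 20 cells are occupied and the set U of
    unoccupied cells has size at most 4.  Let a, b be the halves of a 2-edge, I
    the set of their rows and J the set of their columns.  Avoiding generalized
    cycles says that each cell (k, l) off these rows and columns is in U, or
    row k meets U inside the columns J, or column l meets U inside the rows I.
    If some row k0 and some column l0 both fail to meet U in that way, then
    U has a cell for every row and every column off I and J, and only
    (k0, l0) can be counted twice ([grid_crossing]); together with the unoccupied
    corner that a nondegenerate 2-edge requires, this makes at least 5
    unoccupied cells.  Hence all rows off I meet U in the columns J, or all
    columns off J meet U in the rows I ([two_edge_dichotomy]).

    Extremal graphs have an edge in every row and in every column, and at least
    3 edges in any two rows.  This sharpens the two cases ([two_edge_kinds]): the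
    2-edge is of column kind, where U consists of four cells in different
    rows, all in the two columns J and not all in one of them, or of row kind,
    where the two rows I contain 3 cells of U, 3 edges, and no half but a and b.

    If one 2-edge is of row kind, a second one has no half in its rows; being of
    row kind would put 3 further cells in U, and being of column kind
    would put at most one cell of U in each row: both are absurd.  If all
    are of column kind, they all share the column pair J, as U determines it;
    then U and the six halves are all 10 cells of these two columns, which
    leaves no room for the edge that each column must contain. *)

(** * Counting edges of C4-free graphs *)

(** The same grid of cells is inferred as a finite type in several convertible
    ways, so equal cardinals become syntactically equal only after unfolding.
    They are then made variables, and boolean facts other than inequalities are
    dropped, to spare [lia] the comparison of large terms up to conversion. *)
Ltac card_lia :=
  intros; unfold cell, reverse_coercion in *;
  repeat match goal with
  | H : is_true ?b |- _ => lazymatch b with leq _ _ => fail | _ => clear H end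
  end;
  repeat match goal with
  | |- context [#|?A|] => let c := fresh "c" in set (c := #|A|) in *; clearbody c
  | H : context [#|?A|] |- _ =>
      let c := fresh "c" in set (c := #|A|) in *; clearbody c
  end;
  lia.

Definition rows (m n : nat) (A : {set 'I_m}) : {set cell m n} := setX A setT.
Definition columns (m n : nat) (B : {set 'I_n}) : {set cell m n} := setX setT B.

Lemma in_rows m n (A : {set 'I_m}) (c : cell m n) : (c \in rows n A) = (c.1 \in A).
Proof. by case: c => i j; rewrite in_setX in_setT andbT. Qed.

Lemma in_columns m n (B : {set 'I_n}) (c : cell m n) :
  (c \in columns m B) = (c.2 \in B).
Proof. by case: c => i j; rewrite in_setX in_setT. Qed.

Lemma card_rows m n (A : {set 'I_m}) : #|rows n A| = #|A| * n.
Proof. by rewrite cardsX cardsT card_ord. Qed.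

Lemma card_columns m n (B : {set 'I_n}) : #|columns m B| = m * #|B|.
Proof. by rewrite cardsX cardsT card_ord. Qed.

Definition neighbors (m n : nat) (E : {set cell m n}) (i : 'I_m) : {set 'I_n} :=
  [set j | (i, j) \in E].

Lemma card_edges_rows m n (E : {set cell m n}) (A : {set 'I_m}) :
  #|E :&: rows n A| = \sum_(i in A) #|neighbors E i|.
Proof.
rewrite -sum1_card (partition_big fst (mem A)) /=; last first.
  by move=> c; rewrite inE in_rows => /andP[].
apply: eq_bigr => i iA; rewrite -(card_imset _ (f := pair i)); last by move=> j k [].
rewrite -sum1_card; apply: eq_bigl => -[i' j]; rewrite inE in_rows /=.
apply/andP/imsetP => [[/andP[Eij _] /eqP <-]|[k]].
  by exists j => //; rewrite inE.
by rewrite inE => Eik [-> ->]; rewrite Eik iA.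
Qed.

(** A pair of columns lies in the neighborhoods of at most one row, or else the
    two rows and the two columns would form a C4. *)
Lemma sum_bin_neighbors m n (E : {set cell m n}) (A : {set 'I_m}) (B : {set 'I_n}) :
  ~~ has_C4 E -> (forall i, i \in A -> neighbors E i \subset B) ->
  \sum_(i in A) 'C(#|neighbors E i|, 2) <= 'C(#|B|, 2).
Proof.
move=> C4E subB; rewrite -[X in _ <= X]cards_draws.
pose pairs (X : {set 'I_n}) := [set P : {set 'I_n} | P \subset X & #|P| == 2].
have -> : \sum_(i in A) 'C(#|neighbors E i|, 2) =
    \sum_(i in A) \sum_(P in pairs B | P \subset neighbors E i) 1.
  apply: eq_bigr => i iA; rewrite -cards_draws -sum1_card.
  apply: eq_bigl => P; rewrite !inE andbC -andbA andbCA.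
  case: (boolP (P \subset neighbors E i)) => //= sPN.
    by rewrite (subset_trans sPN (subB i iA)) andbT.
  by rewrite !andbF.
rewrite (exchange_big_dep (mem (pairs B))) /=; last by move=> i P _ /andP[].
rewrite -[X in _ <= X]sum1_card; apply: leq_sum => P; rewrite inE.
case/andP=> _ /cards2P[j [l [njl ->]]].
rewrite sum1_card; apply/card_le1_eqP => i k.
move=> /and3P[_ _ sPi] /and3P[_ _ sPk]; move: sPi sPk.
rewrite !subUset !sub1set !inE => /andP[Eij Eil] /andP[Ekj Ekl].
apply/eqP; apply: contraNT C4E => nik.
apply/existsP; exists i; apply/existsP; exists k.
apply/existsP; exists j; apply/existsP; exists l.
by rewrite eq_sym nik njl Eij Eil Ekj Ekl.
Qed.

(** A line below the convex function 'C(x, 2) turns the bound on pairs into a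
    linear bound on the number of edges. *)
Lemma sum_linear_bin (I : finType) (A : {set I}) (r : I -> nat) a b :
  (forall x, a * x <= 'C(x, 2) + b) ->
  a * \sum_(i in A) r i <= \sum_(i in A) 'C(r i, 2) + b * #|A|.
Proof.
move=> tangent; rewrite mulnC big_distrl /= -[b * _]mulnC -sum_nat_const -big_split /=.
by apply: leq_sum => i _; rewrite mulnC.
Qed.

Lemma tangent1 x : 1 * x <= 'C(x, 2) + 1.
Proof. by case: x => [|[|x]] //; rewrite binS bin1; move: 'C(_, _) => c; lia. Qed.

Lemma tangent2 x : 2 * x <= 'C(x, 2) + 3.
Proof. by case: x => [|[|[|x]]] //; rewrite 2!binS !bin1; move: 'C(_, _) => c; lia. Qed.

Lemma C4_free_rows m (E : {set cell m 4}) (A : {set 'I_m}) :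
  ~~ has_C4 E -> 2 * #|E :&: rows 4 A| <= 6 + 3 * #|A|.
Proof.
move=> C4E; rewrite card_edges_rows.
apply: leq_trans (sum_linear_bin _ _ tangent2) _; rewrite leq_add2r.
have := sum_bin_neighbors (A := A) (B := setT) C4E.
by rewrite cardsT card_ord; apply=> i _; apply: subsetT.
Qed.

(** If column j were empty, only the 3 pairs of the other columns would be
    available, and the five rows could hold no more than 3 + 5 edges. *)
Lemma C4_free_column_nonempty (E : {set cell 5 4}) (j : 'I_4) :
  ~~ has_C4 E -> #|E| = 10 -> 0 < #|E :&: columns 5 [set j]|.
Proof.
move=> C4E cE; rewrite lt0n; apply/negP => /eqP/cards0_eq colj.
have sub i : i \in setT -> neighbors E i \subset ~: [set j].
  move=> _; apply/subsetP => l; rewrite !inE => Eil; apply/eqP => lj.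
  by have /setP/(_ (i, l)) := colj; rewrite in_setI in_columns !inE Eil lj eqxx.
have := sum_bin_neighbors C4E sub; rewrite cardsC1 card_ord.
have := sum_linear_bin setT (fun i => #|neighbors E i|) tangent1.
rewrite -card_edges_rows cardsT card_ord.
have -> : E :&: rows 4 setT = E by apply/setP=> c; rewrite inE in_rows inE andbT.
rewrite cE (_ : 'C(4.-1, 2) = 3) //.
by move: (\sum_(i in _) _) => s; card_lia.
Qed.

(** The rows off A hold at most (6 + 3 * #|~: A|) / 2 edges, so those of A hold
    the rest: at least 1 edge for one row, 3 edges for two rows. *)
Lemma C4_free_few_rows (E : {set cell 5 4}) (A : {set 'I_5}) :
  ~~ has_C4 E -> #|E| = 10 -> 3 * #|A| <= 2 * #|E :&: rows 4 A| + 1.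
Proof.
move=> C4E cE; have := C4_free_rows (~: A) C4E.
have := cardsID (rows 4 A) E; rewrite cE.
have -> : E :\: rows 4 A = E :&: rows 4 (~: A).
  by apply/setP=> c; rewrite in_setD in_setI !in_rows in_setC andbC.
have := cardsC A; rewrite card_ord; card_lia.
Qed.

(** * Occupied and unoccupied cells *)

Definition free (m n : nat) (G : aug_graph m n) : {set cell m n} :=
  [set c | ~~ occupied G c].

Lemma occupiedE m n (G : aug_graph m n) c :
  occupied G c = (c \in edges1 G) || (c \in cover (edges2 G)).
Proof.
congr orb; apply/existsP/bigcupP => [[e /andP[eG ce]]|[e eG ce]].
  by exists e.
by exists e; rewrite eG.
Qed.

Lemma card_cells m n (G : aug_graph m n) (X : {set cell m n}) :
  limited_augmented G ->
  #|X| = #|edges1 G :&: X| + #|cover (edges2 G) :&: X| + #|free G :&: X|.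
Proof.
move=> /and5P[_ _ _ /forall_inP disj _].
rewrite -(cardsID (free G) X) addnC [X :&: _]setIC; congr addn.
have -> : X :\: free G = (edges1 G :&: X) :|: (cover (edges2 G) :&: X).
  apply/setP=> c; rewrite !in_setU in_setD !in_setI inE occupiedE negbK.
  by case: (c \in X); rewrite ?andbT ?andbF.
suff sep : (edges1 G :&: X) :&: (cover (edges2 G) :&: X) = set0.
  by rewrite cardsU sep cards0 subn0.
apply/setP=> c; rewrite !in_setI in_set0; apply/negbTE/negP.
case/andP=> /andP[cE _] /andP[/bigcupP[e eG ce] _].
by have /disjointFr/(_ ce) := disj e eG; rewrite cE.
Qed.

Lemma card_cover_edges2 m n (G : aug_graph m n) :
  limited_augmented G -> #|cover (edges2 G)| = 2 * #|edges2 G|.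
Proof.
move=> /and5P[_ _ /forall_inP c2 _ /eqP <-].
by rewrite mulnC -sum_nat_const; apply: eq_bigr => e /c2/eqP.
Qed.

Lemma two_edge_sub_cover m n (G : aug_graph m n) a b :
  [set a; b] \in edges2 G ->
  (a \in cover (edges2 G)) && (b \in cover (edges2 G)).
Proof.
by move=> abG; apply/andP; split; apply/bigcupP; exists [set a; b];
  rewrite // !inE eqxx ?orbT.
Qed.

Lemma free_opposite_corner m n (G : aug_graph m n) a b :
  ~~ has_gen_C4 G -> [set a; b] \in edges2 G -> nondegenerate a b ->
  ((a.1, b.2) \in free G) || ((b.1, a.2) \in free G).
Proof.
case: a b => [i j] [p q]; rewrite !negb_or => /and3P[_ noC _] eG nd.
rewrite !inE -negb_and; apply: contra noC => /andP[oc1 oc2].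
apply/existsP; exists i; apply/existsP; exists j.
by apply/existsP; exists p; apply/existsP; exists q; rewrite eG nd oc1.
Qed.

(** For k and l off the rows and columns of the 2-edge, the five cells of the
    third kind of cycle are automatically distinct, so one must be unoccupied. *)
Lemma free_three m n (G : aug_graph m n) a b k l :
  ~~ has_gen_C4 G -> [set a; b] \in edges2 G ->
  k \notin [set a.1; b.1] -> l \notin [set a.2; b.2] ->
  [\/ (k, l) \in free G,
      exists2 j, j \in [set a.2; b.2] & (k, j) \in free G
    | exists2 i, i \in [set a.1; b.1] & (i, l) \in free G].
Proof.
case: a b => [i j] [p q] /= noC eG.
rewrite !in_set2 !negb_or => /andP[ki kp] /andP[lj lq].
case: (boolP (occupied G (k, l))) => [okl|?]; last by constructor 1; rewrite inE.
case: (boolP (occupied G (k, j))) => [okj|?]; last first.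
  by constructor 2; exists j; rewrite !inE ?eqxx.
case: (boolP (occupied G (k, q))) => [okq|?]; last first.
  by constructor 2; exists q; rewrite !inE ?eqxx ?orbT.
case: (boolP (occupied G (i, l))) => [oil|?]; last first.
  by constructor 3; exists i; rewrite !inE ?eqxx.
case: (boolP (occupied G (p, l))) => [opl|?]; last first.
  by constructor 3; exists p; rewrite !inE ?eqxx ?orbT.
case/negP: noC; rewrite /has_gen_C4; apply/or3P; constructor 3.
apply/existsP; exists i; apply/existsP; exists j; apply/existsP; exists p.
apply/existsP; exists q; apply/existsP; exists k; apply/existsP; exists l.
rewrite eG /= !inE !negb_or ki kp lj lq okl okj okq oil opl /=.
apply/implyP => /andP[/= nip njq]; rewrite !xpair_eqE.
by rewrite !(negbTE ki, negbTE kp, negbTE lj, negbTE lq, negbTE nip, negbTE njq)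
  ?andbF ?andFb.
Qed.

(** * The two kinds of 2-edges *)

(** If row k0 and column l0 refute the first two cases, each row off I has a cell
    of U in the columns l0 |: J, by the hypothesis at (k, l0), and each column
    off J has a cell of U in the rows k0 |: I, by the hypothesis at (k0, l).
    The two families of cells can only share (k0, l0). *)
Lemma grid_crossing m n (U : {set cell m n}) (I : {set 'I_m}) (J : {set 'I_n}) :
  (forall k l, k \notin I -> l \notin J ->
    [\/ (k, l) \in U, exists2 j, j \in J & (k, j) \in U
      | exists2 i, i \in I & (i, l) \in U]) ->
  [\/ forall k, k \notin I -> exists2 j, j \in J & (k, j) \in U,
      forall l, l \notin J -> exists2 i, i \in I & (i, l) \in U
    | #|~: I| + #|~: J| <= #|U :\: setX I J| + 1].
Proof.
move=> cross.
pose rowP k := [exists j in J, (k, j) \in U].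
pose colP l := [exists i in I, (i, l) \in U].
case: (boolP [forall k in ~: I, rowP k]) => [/forall_inP rP|].
  by constructor 1 => k kI; have /rP/exists_inP : k \in ~: I by rewrite inE.
case: (boolP [forall l in ~: J, colP l]) => [/forall_inP cP _|].
  by constructor 2 => l lJ; have /cP/exists_inP : l \in ~: J by rewrite inE.
rewrite !negb_forall => /existsP[l0]; rewrite negb_imply inE => /andP[l0J Nl0].
move=> /existsP[k0]; rewrite negb_imply inE => /andP[k0I Nk0].
constructor 3.
pose W := U :\: setX I J.
pose VK := [set c in W | (c.1 \notin I) && (c.2 \in l0 |: J)].
pose VL := [set c in W | (c.2 \notin J) && (c.1 \in k0 |: I)].
have leK : #|~: I| <= #|VK|.
  apply: leq_trans (leq_imset_card fst _); apply: subset_leq_card.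
  apply/subsetP=> k; rewrite inE => kI.
  have [kl|[j jJ kj]|[i iI il]] := cross k l0 kI l0J.
  - by apply/imsetP; exists (k, l0); rewrite // !inE /= kl (negbTE kI) eqxx.
  - by apply/imsetP; exists (k, j); rewrite // !inE /= kj (negbTE kI) jJ orbT.
  - by case/exists_inP: Nl0; exists i.
have leL : #|~: J| <= #|VL|.
  apply: leq_trans (leq_imset_card snd _); apply: subset_leq_card.
  apply/subsetP=> l; rewrite inE => lJ.
  have [kl|[j jJ kj]|[i iI il]] := cross k0 l k0I lJ.
  - by apply/imsetP; exists (k0, l); rewrite // !inE /= kl (negbTE lJ) eqxx andbF.
  - by case/exists_inP: Nk0; exists j.
  - by apply/imsetP; exists (i, l); rewrite // !inE /= il (negbTE lJ) iI orbT andbF.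
have meet : #|VK :&: VL| <= 1.
  rewrite -(cards1 (k0, l0)); apply: subset_leq_card; apply/subsetP=> -[k l].
  rewrite !inE /= xpair_eqE => /andP[/and3P[_ kI]] + /and3P[_ lJ].
  by rewrite (negbTE kI) (negbTE lJ) !orbF => -> ->.
have join : #|VK :|: VL| <= #|W|.
  apply: subset_leq_card; apply/subsetP=> c; rewrite in_setU ![c \in [set _ in _ | _]]inE.
  by case/orP=> /andP[].
have := cardsUI VK VL; rewrite -/W; card_lia.
Qed.

(** The cell of U at a corner of a nondegenerate 2-edge lies in the rows I and
    the columns J, so it adds to each of the three counts of [grid_crossing]. *)
Lemma two_edge_dichotomy m n (G : aug_graph m n) a b
    (I := [set a.1; b.1]) (J := [set a.2; b.2]) :
  ~~ has_gen_C4 G -> [set a; b] \in edges2 G ->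
  [\/ m + nondegenerate a b <= #|fst @: (free G :&: columns m J)| + #|I|,
      n + nondegenerate a b <= #|snd @: (free G :&: rows n I)| + #|J|
    | m + n + nondegenerate a b <= #|free G| + #|I| + #|J| + 1].
Proof.
move=> noC eG; set U := free G.
have cardI : #|I| + #|~: I| = m by rewrite cardsC card_ord.
have cardJ : #|J| + #|~: J| = n by rewrite cardsC card_ord.
have corner : nondegenerate a b -> exists2 c, c \in U & (c.1 \in I) && (c.2 \in J).
  move=> nd; case/orP: (free_opposite_corner noC eG nd) => cU.
    by exists (a.1, b.2); rewrite // !inE !eqxx /= !orbT.
  by exists (b.1, a.2); rewrite // !inE !eqxx /= !orbT.
have [rP|cP|many] := grid_crossing (fun k l => @free_three _ _ G a b k l noC eG).
- constructor 1; set R := fst @: _.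
  have subR : ~: I \subset R.
    apply/subsetP=> k; rewrite inE => /rP[j jJ kU].
    by apply/imsetP; exists (k, j); rewrite // in_setI in_columns kU.
  have leR : (nondegenerate a b : nat) <= #|R :&: I|.
    case: (boolP (nondegenerate a b)) => // /corner[c cU /andP[cI cJ]].
    apply/card_gt0P; exists c.1; rewrite inE cI andbT.
    by apply/imsetP; exists c; rewrite // in_setI in_columns cU.
  have := cardsID I R; have : #|~: I| <= #|R :\: I|; last card_lia.
  by apply: subset_leq_card; rewrite setDE subsetI subR subxx.
- constructor 2; set R := snd @: _.
  have subR : ~: J \subset R.
    apply/subsetP=> k; rewrite inE => /cP[i iI kU].
    by apply/imsetP; exists (i, k); rewrite // in_setI in_rows kU.
  have leR : (nondegenerate a b : nat) <= #|R :&: J|.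
    case: (boolP (nondegenerate a b)) => // /corner[c cU /andP[cI cJ]].
    apply/card_gt0P; exists c.2; rewrite inE cJ andbT.
    by apply/imsetP; exists c; rewrite // in_setI in_rows cU.
  have := cardsID J R; have : #|~: J| <= #|R :\: J|; last card_lia.
  by apply: subset_leq_card; rewrite setDE subsetI subR subxx.
- constructor 3; rewrite -/I -/J -/U in many *.
  have : (nondegenerate a b : nat) <= #|U :&: setX I J|.
    case: (boolP (nondegenerate a b)) => // /corner[[i j] cU cIJ].
    by apply/card_gt0P; exists (i, j); rewrite in_setI cU in_setX.
  have := cardsID (setX I J) U; card_lia.
Qed.

(** The shape forced on U by a 2-edge whose other rows all meet U in its two
    columns. *)
Definition column_kind (m n : nat) (U : {set cell m n}) (a b : cell m n) : Prop :=
  [/\ a.2 != b.2, snd @: U = [set a.2; b.2], #|U| = 4 & {in U &, injective fst}].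

Definition row_kind (m n : nat) (G : aug_graph m n) (a b : cell m n) : Prop :=
  [/\ a.1 != b.1, 3 <= #|free G :&: rows n [set a.1; b.1]|
    & cover (edges2 G) :&: rows n [set a.1; b.1] = [set a; b]].

(** In the dichotomy, a 2-edge within one column cannot meet U in all other rows:
    the column would be filled by 3 cells of U and 2 halves, without an edge.
    Dually, a 2-edge within one row cannot meet U in both other columns.  When U
    lies in the columns J, it cannot be inside one of them, because that
    column also needs a half and an edge, 6 cells in all. *)
Lemma two_edge_kinds (G : aug_graph 5 4) a b :
  limited_augmented G -> ~~ has_gen_C4 G -> #|edges1 G| = 10 ->
  #|free G| <= 4 -> a != b -> [set a; b] \in edges2 G ->
  column_kind (free G) a b \/ row_kind G a b.
Proof.
move=> lG noC cE1 cU nab eG; have [C4E _ _ _ _] := and5P lG.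
have /andP[aC bC] := two_edge_sub_cover eG.
pose I := [set a.1; b.1]; pose J := [set a.2; b.2].
have cI : #|I| = (a.1 != b.1).+1 by rewrite cards2.
have cJ : #|J| = (a.2 != b.2).+1 by rewrite cards2.
have cIJ : #|I| + #|J| = 3 + nondegenerate a b.
  rewrite cI cJ /nondegenerate; case: (a) (b) nab => [i j] [p q]; rewrite xpair_eqE /=.
  by case: (i == p); case: (j == q).
have halves (X : {set cell 5 4}) :
    a \in X -> b \in X -> [set a; b] \subset cover (edges2 G) :&: X.
  by move=> aX bX; rewrite subUset !sub1set !inE aC bC aX bX.
have colpos j : 0 < #|edges1 G :&: columns 5 [set j]|.
  exact: C4_free_column_nonempty.
have := two_edge_dichotomy noC eG; rewrite -/I -/J => -[manyC|manyR|]; last by card_lia.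
- left; set U := free G in cU manyC *.
  have leU : #|fst @: (U :&: columns 5 J)| <= #|U :&: columns 5 J|
    by apply: leq_imset_card.
  have leUU : #|U :&: columns 5 J| <= #|U| by apply/subset_leq_card/subsetIl.
  have nj : a.2 != b.2.
    apply/negP => /eqP eqj; have JE : J = [set a.2] by rewrite /J eqj setUid.
    have := card_cells (columns 5 J) lG; rewrite card_columns -/U.
    have := colpos a.2; rewrite -JE.
    have := subset_leq_card (halves (columns 5 J) _ _).
    rewrite !in_columns !inE !eqxx orbT cards2 nab => /(_ isT isT).
    by rewrite cJ eqj eqxx in cIJ *; card_lia.
  have {}cJ : #|J| = 2 by rewrite cJ nj.
  have UJ : U :&: columns 5 J = U by apply/eqP; rewrite eqEcard subsetIl andTb; card_lia.
  rewrite UJ in leU leUU manyC *.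
  have {}cU : #|U| = 4 by card_lia.
  have inj : {in U &, injective fst} by apply/imset_injP/eqP; card_lia.
  (* A column with a half and an edge has room for only 3 unoccupied cells. *)
  have full c : c \in cover (edges2 G) -> U \subset columns 5 [set c.2] -> False.
    move=> cC /setIidPl Uc; have := card_cells (columns 5 [set c.2]) lG.
    rewrite card_columns cards1 -/U Uc cU; have := colpos c.2.
    have : 0 < #|cover (edges2 G) :&: columns 5 [set c.2]|; last card_lia.
    by apply/card_gt0P; exists c; rewrite in_setI cC in_columns inE eqxx.
  have inJ u : u \in U -> (u.2 == a.2) || (u.2 == b.2).
    by rewrite -{1}UJ in_setI in_columns !inE => /andP[].
  split=> //; apply/eqP; rewrite eqEsubset; apply/andP; split; apply/subsetP => j.
    by case/imsetP=> u /inJ uJ ->; rewrite !inE.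
  rewrite !inE => jJ; apply/negPn/negP => jU.
  have nU u : u \in U -> u.2 != j.
    by move=> uU; apply: contra jU => /eqP <-; apply: imset_f.
  case/orP: jJ => /eqP jE; [apply: (full b bC) | apply: (full a aC)];
    apply/subsetP => u uU; rewrite in_columns inE;
    by have := inJ u uU; have := nU u uU; rewrite jE => /negbTE-> //; rewrite orbF.
- right; set R := rows 4 I.
  have leU : #|snd @: (free G :&: R)| <= #|free G :&: R| by apply: leq_imset_card.
  have sub : [set a; b] \subset cover (edges2 G) :&: R.
    by apply: halves; rewrite in_rows !inE eqxx ?orbT.
  have := subset_leq_card sub; rewrite cards2 nab.
  have := card_cells R lG; rewrite card_rows => splitR le2.
  have leE := C4_free_few_rows I C4E cE1; rewrite -/R in leE manyR.
  have ni : a.1 != b.1.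
    by move: cI; case: (a.1 != b.1) => // cI; card_lia.
  have {}cI : #|I| = 2 by rewrite cI ni.
  split=> //; first by rewrite -/I -/R; card_lia.
  by apply/eqP; rewrite eq_sym eqEcard sub cards2 nab -/I -/R; card_lia.
Qed.

(** * No three 2-edges *)

Lemma at_most_two_2edges (G : aug_graph 5 4) :
  limited_augmented G -> ~~ has_gen_C4 G -> #|edges1 G| = 10 -> #|edges2 G| <= 2.
Proof.
move=> lG noC cE1; rewrite leqNgt; apply/negP => gt2.
have [C4E _ /forall_inP c2 _ triv] := and5P lG.
set U := free G; set C := cover (edges2 G).
have cC : #|C| = 2 * #|edges2 G| by apply: card_cover_edges2.
have := card_cells setT lG; rewrite !setIT cE1 -/U -/C.
rewrite cardsT card_prod !card_ord => split20.
have cU : #|U| <= 4 by card_lia.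
have kinds e : e \in edges2 G -> exists a b,
    [/\ e = [set a; b], a != b & column_kind U a b \/ row_kind G a b].
  move=> eG; have /cards2P[a [b [nab eE]]] := c2 e eG.
  by exists a, b; split=> //; apply: two_edge_kinds; rewrite -?eE.
(* A second 2-edge avoids the two rows of [e], which hold 3 of the at most 4
   unoccupied cells. *)
have no_row_kind e a b : e \in edges2 G -> e = [set a; b] -> ~ row_kind G a b.
  move=> eG eE [nab U3 CR]; rewrite -/U -/C in U3 CR.
  have [e' e'G ne] : exists2 e', e' \in edges2 G & e' != e.
    have /card_gt0P[e'] : 0 < #|edges2 G :\ e| by have := cardsD1 e (edges2 G); card_lia.
    by rewrite !inE => /andP[]; exists e'.
  have [a' [b' [e'E _ [[_ _ _ inj]|[_ U3' _]]]]] := kinds e' e'G.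
    have : #|U :&: rows 4 [set a.1; b.1]| <= 2; last card_lia.
    rewrite -(card_in_imset (f := fst)); last first.
      by move=> u v; rewrite !in_setI => /andP[uU _] /andP[vU _]; apply: inj.
    have cI : #|[set a.1; b.1]| <= 2 by rewrite cards2 nab.
    apply: leq_trans (subset_leq_card _) cI; apply/subsetP=> _ /imsetP[u + ->].
    by rewrite in_setI in_rows => /andP[].
  have out c : c \in e' -> c.1 \notin [set a.1; b.1].
    move=> ce'; rewrite -in_rows; apply/negP => cR.
    have : c \in C :&: rows 4 [set a.1; b.1].
      by rewrite in_setI cR andbT; apply/bigcupP; exists e'.
    rewrite CR -eE => ce.
    by have /trivIsetP/(_ _ _ e'G eG ne)/disjointFr/(_ ce') := triv; rewrite ce.
  have disj : (U :&: rows 4 [set a.1; b.1]) :&: (U :&: rows 4 [set a'.1; b'.1]) = set0.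
    apply/setP=> u; rewrite !in_setI !in_rows in_set0; apply/negP.
    case/andP=> /andP[_ uI] /andP[_]; rewrite !in_set2.
    by case/orP=> /eqP uE; [have := out a' | have := out b'];
       rewrite e'E !inE eqxx ?orbT -uE => /(_ isT); rewrite -in_set2 uI.
  have := cardsUI (U :&: rows 4 [set a.1; b.1]) (U :&: rows 4 [set a'.1; b'.1]).
  rewrite disj cards0 -/U in U3' *.
  have : #|U :&: rows 4 [set a.1; b.1] :|: U :&: rows 4 [set a'.1; b'.1]| <= #|U|.
    by apply: subset_leq_card; rewrite subUset !subsetIl.
  card_lia.
have colk e : e \in edges2 G -> exists a b, e = [set a; b] /\ column_kind U a b.
  move=> eG; have [a [b [eE _ [ck|rk]]]] := kinds e eG; first by exists a, b.
  by case: (no_row_kind e a b eG eE rk).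
have /card_gt0P[e eG] : 0 < #|edges2 G| by card_lia.
have [a [b [_ [nj sndU cU4 _]]]] := colk e eG.
pose J := [set a.2; b.2].
(* All 2-edges share the columns J, which U determines. *)
have CJ : C :&: columns 5 J = C.
  apply/setIidPl/subsetP => c /bigcupP[e' e'G ce'].
  have [a' [b' [e'E [_ sndU' _ _]]]] := colk e' e'G.
  rewrite in_columns /J -sndU sndU' !inE; move: ce'; rewrite e'E !inE.
  by case/orP=> /eqP->; rewrite eqxx ?orbT.
have UJ : U :&: columns 5 J = U.
  by apply/setIidPl/subsetP => u uU; rewrite in_columns /J -sndU imset_f.
have := card_cells (columns 5 J) lG; rewrite -/U -/C CJ UJ card_columns cards2 nj.
have /card_gt0P[c] := C4_free_column_nonempty a.2 C4E cE1.
rewrite in_setI in_columns inE => /andP[cE /eqP cj].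
have : 0 < #|edges1 G :&: columns 5 J|; last card_lia.
by apply/card_gt0P; exists c; rewrite in_setI cE in_columns cj !inE eqxx.
Qed.

(** * A graph with two 2-edges *)

Lemma eq_set2 (T : finType) (x y a b : T) :
  [set x; y] = [set a; b] -> (x, y) \in [:: (a, b); (b, a)].
Proof.
move=> eqS.
have /set2P xS : x \in [set a; b] by rewrite -eqS set21.
have /set2P yS : y \in [set a; b] by rewrite -eqS set22.
have /set2P aS : a \in [set x; y] by rewrite eqS set21.
have /set2P bS : b \in [set x; y] by rewrite eqS set22.
move: aS bS; case: xS => ->; case: yS => ->; rewrite !inE ?eqxx ?orbT //.
  by move=> _ [] ->; rewrite eqxx.
by move=> [] -> _; rewrite eqxx.
Qed.

Notation at_ i j := ((@Ordinal 5 i isT, @Ordinal 4 j isT) : cell 5 4).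

(** The graph below, where the 2-edges join the two cells [a] and the two cells
    [b].  Its rows are all pairs of columns but the last one.
<<
      1 1 a .
      1 . 1 a
      1 b . 1
      . 1 1 .
      . 1 b 1
>>
*)
Definition ones : seq (cell 5 4) :=
  [:: at_ 0 0; at_ 0 1; at_ 1 0; at_ 1 2; at_ 2 0; at_ 2 3;
      at_ 3 1; at_ 3 2; at_ 4 1; at_ 4 3].

Definition witness : aug_graph 5 4 :=
  ([set c in ones],
   [set [set at_ 0 2; at_ 1 3]; [set at_ 2 1; at_ 4 2]]).

Lemma card_ones : #|edges1 witness| = 10.
Proof. by rewrite cardsE; apply/card_uniqP. Qed.

Ltac case_ord5 i := case: i => [[|[|[|[|[|//]]]]] ?].
Ltac case_ord4 j := case: j => [[|[|[|[|//]]]] ?].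

Lemma C4_free_ones : ~~ has_C4 (edges1 witness).
Proof.
apply/negP => /existsP[i /existsP[k /existsP[j /existsP[l]]]].
rewrite !in_set.
by case_ord5 i; case_ord5 k => //; case_ord4 j => //; case_ord4 l.
Qed.

Lemma zarankiewicz_5_4 : zarankiewicz 5 4 = 10.
Proof.
apply/eqP; rewrite eqn_leq; apply/andP; split; last first.
  by rewrite -card_ones /zarankiewicz
    (bigD1 (edges1 witness)) ?C4_free_ones ?leq_maxl.
apply/bigmax_leqP => E /(C4_free_rows setT).
have -> : E :&: rows 4 setT = E by apply/setP=> c; rewrite inE in_rows inE andbT.
by rewrite cardsT card_ord; lia.
Qed.

Lemma witness_2edge c d : [set c; d] \in edges2 witness ->
  (c, d) \in [:: (at_ 0 2, at_ 1 3); (at_ 1 3, at_ 0 2);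
                 (at_ 2 1, at_ 4 2); (at_ 4 2, at_ 2 1)].
Proof.
by case/set2P=> /eq_set2; rewrite !in_cons !in_nil !orbF => /orP[] ->; rewrite ?orbT.
Qed.

Lemma witness_occupied c : occupied witness c =
  (c \in ones ++ [:: at_ 0 2; at_ 1 3; at_ 2 1; at_ 4 2]).
Proof.
rewrite occupiedE mem_cat in_set; congr orb.
apply/bigcupP/idP => [[e /set2P[] -> /set2P[] ->]|] //.
rewrite !in_cons in_nil orbF => /or4P[] /eqP->;
  [exists [set at_ 0 2; at_ 1 3] | exists [set at_ 0 2; at_ 1 3]
  | exists [set at_ 2 1; at_ 4 2] | exists [set at_ 2 1; at_ 4 2]];
  by rewrite ?set21 ?set22.
Qed.

Lemma limited_augmented_witness : limited_augmented witness.
Proof.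
apply/and5P; split; first exact: C4_free_ones.
- by rewrite card_ones zarankiewicz_5_4.
- by apply/forall_inP=> e /set2P[] ->; rewrite cards2.
- apply/forall_inP=> e /set2P[] ->; rewrite disjoint_subset;
  by apply/subsetP=> c /set2P[] ->; rewrite !inE.
- apply/trivIsetP=> e f /set2P[] -> /set2P[] ->; rewrite ?eqxx // => _;
  rewrite disjoint_subset; apply/subsetP=> c /set2P[] ->; by rewrite !inE.
Qed.

Lemma no_gen_C4_witness : ~~ has_gen_C4 witness.
Proof.
rewrite /has_gen_C4 (negbTE C4_free_ones) /= negb_or; apply/andP; split; apply/negP.
  case/existsP=> i /existsP[j /existsP[k /existsP[l]]].
  rewrite !witness_occupied; case/and4P=> /witness_2edge; rewrite !in_cons in_nil orbF.
  by case/or4P=> /eqP[-> -> -> ->].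
case/existsP=> i /existsP[j /existsP[p /existsP[q /existsP[k /existsP[l]]]]].
rewrite /all !witness_occupied => /andP[/witness_2edge].
rewrite !in_cons in_nil orbF.
by case/or4P=> /eqP[-> -> -> ->]; case_ord5 k => //; case_ord4 l.
Qed.

Theorem theorem4p4 : limited_zarankiewicz 5 4 = 12.
Proof.
apply/eqP; rewrite eqn_leq; apply/andP; split.
  apply/bigmax_leqP => G /andP[lG noC].
  have cE1 : #|edges1 G| = 10.
    by case/and5P: lG => _ /eqP-> _ _ _; apply: zarankiewicz_5_4.
  by rewrite cE1 leq_add2l at_most_two_2edges.
have cE2 : #|edges2 witness| = 2.
  by rewrite cards2; case: eqP => // /eq_set2.
have <- : #|edges1 witness| + #|edges2 witness| = 12 by rewrite card_ones cE2.
rewrite /limited_zarankiewicz (bigD1 witness) ?leq_maxl //.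
by rewrite limited_augmented_witness no_gen_C4_witness.
Qed.
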